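(* Let $u^{(1)},\dots,u^{(k)}$ ($k\ge1$) be integer intervals in $[1,n]$ with $I_{maxl}=\max_i u^{(i)}_l$ and $I_{minr}=\min_i u^{(i)}_r$, let $D$ be any set of pawn-squares, and let $\rho=\bigl(\bigcap_i v_{u^{(i)}}\bigr)\setminus D$. Let $u=[u_l,u_r]\subseteq[1,n]$ be an interval with $v_u\cap\rho=\emptyset$ and $I_{minr}<u_l$. Then for every interval $\mu=[\mu_l,\mu_r]\subseteq[1,n]$ processed after $u$ (so that $u_l\le\mu_l$), $v_\mu\cap\rho=\emptyset$.
   Context: Board: $n\times n$, files and ranks numbered $1,\dots,n$. A pawn-square is a square $s$ at file $f$, rank $r$ with $2\le r\le n-1$; its set of potential starting files is $\mu_s=\{g\in\mathbb{Z}:\max(1,f-(r-2))\le g\le\min(n,f+(r-2))\}$. For an integer interval $u\subseteq[1,n]$, $v_u$ is the set of pawn-squares $s$ with $\mu_s\subseteq u$. Intervals are processed in lexicographic order of (left endpoint, right endpoint). *)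

(* Defs.v *)
From mathcomp Require Import all_boot all_order all_algebra.
From mathcomp Require Import all_classical.

Set Implicit Arguments.
Unset Strict Implicit.
Unset Printing Implicit Defensive.

Import Order.TTheory GRing.Theory Num.Theory.
Local Open Scope classical_set_scope.
Local Open Scope ring_scope.

(* (file, rank), both numbered from 1 *)
Definition square : Type := (int * int)%type.
Definition file (s : square) : int := s.1.
Definition rank (s : square) : int := s.2.

Definition pawn_squares (n : nat) : set square :=
  [set s | 1 <= file s <= n%:Z /\ 2 <= rank s <= n%:Z - 1].

Definition start_files (n : nat) (s : square) : set int :=
  [set g | Num.max 1 (file s - (rank s - 2)) <= g
           <= Num.min n%:Z (file s + (rank s - 2))].

(* An integer interval is given by its endpoints; see [interval_in] for the
   requirement that it be nonempty, so that the endpoints are determined. *)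
Definition zinterval : Type := (int * int)%type.
Definition lend (u : zinterval) : int := u.1.
Definition rend (u : zinterval) : int := u.2.

Definition zset (u : zinterval) : set int := `[lend u, rend u]%classic.

Definition interval_in (n : nat) (u : zinterval) : Prop :=
  lend u <= rend u /\ zset u `<=` `[1, n%:Z]%classic.

Definition vset (n : nat) (u : zinterval) : set square :=
  [set s | pawn_squares n s /\ start_files n s `<=` zset u].

Definition processed_before (u v : zinterval) : Prop :=
  ((u : (int *l int)%type) < (v : (int *l int)%type))%O.

(* The default values 1 and n are neutral for families of intervals in [1, n],
   so for k > 0 these are the maximum and the minimum over the family. *)
Definition max_lend (k : nat) (u : 'I_k -> zinterval) : int :=
  \big[Num.max/1]_(i < k) lend (u i).
Definition min_rend (n k : nat) (u : 'I_k -> zinterval) : int :=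
  \big[Num.min/n%:Z]_(i < k) rend (u i).

(* Main.v *)
(* A pawn-square s has rank at least 2, so its own file is one of its potential
   starting files.  Hence file s lies in every interval u with s in v_u: for s in
   rho this gives file s <= Iminr, and for s in v_mu it gives mu_l <= file s,
   which is incompatible with Iminr < u_l <= mu_l. *)

Require Import Defs.
From mathcomp Require Import all_boot all_order all_algebra.
From mathcomp Require Import all_classical.

Import Order.TTheory GRing.Theory Num.Theory.
Local Open Scope classical_set_scope.
Local Open Scope ring_scope.

Lemma file_start_files (n : nat) (s : square) :
  pawn_squares n s -> start_files n s (file s).
Proof.
move=> [/andP[f1 fn] /andP[r2 _]]; rewrite /start_files /=.
(* Apart from the board bounds, both inequalities reduce to [0 <= rank s - 2]. *)
by rewrite ge_max le_min f1 fn lerBlDr lerDl subr_ge0 r2.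
Qed.

Lemma vset_file (n : nat) (u : zinterval) (s : square) :
  vset n u s -> lend u <= file s <= rend u.
Proof.
move=> [/file_start_files sf /(_ _ sf)].
by rewrite /zset /= in_itv.
Qed.

Theorem theorem7 (n k : nat) (hk : (1 <= k)%N) (us : 'I_k -> zinterval)
  (hus : forall i, interval_in n (us i))
  (Imaxl Iminr : int)
  (hImaxl : Imaxl = max_lend us) (hIminr : Iminr = min_rend n us)
  (D : set square) (hD : D `<=` pawn_squares n)
  (rho : set square)
  (hrho : rho = (\bigcap_(i in [set: 'I_k]) vset n (us i)) `\` D)
  (u : zinterval) (hu : interval_in n u)
  (hvu : vset n u `&` rho = set0) (hlt : Iminr < lend u) :
  forall mu : zinterval, interval_in n mu -> processed_before u mu ->
    vset n mu `&` rho = set0.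
Proof.
move=> mu _ u_mu; apply/seteqP; split=> // s [smu].
rewrite hrho => -[srho _].
(* The lexicographic order compares left endpoints only weakly; the strictness needed at the end
   comes from [hlt]. *)
have le_u_mu : lend u <= lend mu.
  by move: u_mu; rewrite /processed_before ltEprodlexi => /andP[].
have le_fI : file s <= Iminr.
  (* The default value [n] of the minimum adds the goal [file s <= n], true because [s] lies on the
     board. *)
  rewrite hIminr; apply/bigmin_geP; split=> [|i _].
    by have [[/andP[]]] := smu.
  by have /andP[] := vset_file _ _ _ (srho i I).
have /andP[le_mu_f _] := vset_file _ _ _ smu.
by have := lt_le_trans hlt (le_trans le_u_mu (le_trans le_mu_f le_fI)); rewrite ltxx.
Qed.
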